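(* Let $S$ be a connected cluster-acyclic quiver of order $3$. Then: 1) the mutation class of $S$ contains a unique (up to change of orientations of edges) quiver $S_0$ without oriented cycle; 2) the total weight of $S_0$ is minimal amongst all quivers of the mutation class of $S$; 3) any sequence of mutations applied to $S$ which decreases the total weight at each step, and which cannot be prolonged by a further mutation decreasing the total weight, ends in $S_0$ (up to change of orientations of edges).
   Context: A quiver is a finite directed multigraph without loops and oriented $2$-cycles; parallel arrows are recorded as one edge with a positive integer weight. A quiver with vertices $1,\dots,n$ is the same as a skew-symmetric integer $n\times n$ matrix $B$: if $B_{ij}>0$ there is an edge $i\to j$ of weight $B_{ij}$. The order of a quiver is its number of vertices. The mutation in direction $k$ sends $B$ to $B'$ with $B'_{ij}=-B_{ij}$ if $i=k$ or $j=k$, and $B'_{ij}=B_{ij}+\frac{|B_{ik}|B_{kj}+B_{ik}|B_{kj}|}{2}$ otherwise. The mutation class of a quiver is the set of all quivers obtained from it by finite sequences of mutations; here quivers are considered up to isomorphism (relabeling of vertices). A quiver of order $3$ is cyclic if it is an oriented cycle (all three edges are present and form an oriented triangle), and acyclic otherwise. It is cluster-cyclic if every quiver mutation-equivalent to it is cyclic, and cluster-acyclic otherwise. The total weight of a quiver is the sum of the weights of its edges. ''Up to change of orientations of edges'' means: up to isomorphism of the underlying weighted unoriented graphs (among acyclic quivers). *)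

(* Defs.v *)
From mathcomp Require Import all_boot all_order all_algebra all_fingroup.

Set Implicit Arguments.
Unset Strict Implicit.
Unset Printing Implicit Defensive.

Import Order.TTheory GRing.Theory Num.Theory.

Local Open Scope ring_scope.

(* Entry (i, j) is the weight of the edge i -> j when it is positive; there is
   no edge from i to j otherwise. Skew-symmetry over int makes the diagonal
   zero, so loops and oriented 2-cycles are excluded. *)
Record quiver (n : nat) := Quiver {
  quiver_mx :> 'M[int]_n;
  quiver_skew : quiver_mx^T = - quiver_mx
}.

(* The division is always exact, see even_mutation_term. *)
Definition mutate_mx n (B : 'M[int]_n) (k : 'I_n) : 'M[int]_n :=
  \matrix_(i, j)
    if (i == k) || (j == k) then - B i j
    else B i j + ((`|B i k| * B k j + B i k * `|B k j|) %/ 2)%Z.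

Lemma even_mutation_term (a b : int) : (2 %| `|a| * b + a * `|b|)%Z.
Proof.
have dvd2D (x : int) : (2 %| x + x)%Z.
  by apply/dvdzP; exists x; rewrite mulrDr mulr1.
by have [_|_] := ger0P a; have [_|_] := ger0P b;
  rewrite ?mulNr ?mulrN ?addrN ?addNr ?dvdz0 ?dvd2D.
Qed.

Lemma mutate_skew n (Q : quiver n) (k : 'I_n) :
  (mutate_mx Q k)^T = - mutate_mx Q k.
Proof.
have skE i j : Q j i = - Q i j.
  by have /matrixP/(_ i j) := quiver_skew Q; rewrite !mxE.
apply/matrixP => i j; rewrite !mxE orbC (skE i j).
case: ifP => // _; rewrite opprD; congr (_ + _).
have -> : `|Q j k| * Q k i + Q j k * `|Q k i|
    = - (`|Q i k| * Q k j + Q i k * `|Q k j|).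
  rewrite (skE k j) (skE i k) !normrN mulrN mulNr -opprD addrC.
  by rewrite mulrC [X in _ + X]mulrC.
have /dvdzP[q ->] := even_mutation_term (Q i k) (Q k j).
by rewrite -mulNr !mulzK.
Qed.

Definition mutate n (Q : quiver n) (k : 'I_n) : quiver n :=
  Quiver (mutate_skew Q k).

Definition mutate_seq n (Q : quiver n) (ks : seq 'I_n) : quiver n :=
  foldl (@mutate n) Q ks.

Definition isomorphic n (Q Q' : quiver n) : Prop :=
  exists s : 'S_n, forall i j, Q' (s i) (s j) = Q i j.

(* Membership of Q' in the mutation class of Q; quivers are taken up to
   relabelling of the vertices. *)
Definition mutation_equivalent n (Q Q' : quiver n) : Prop :=
  exists ks : seq 'I_n, isomorphic (mutate_seq Q ks) Q'.

Definition same_underlying_graph n (Q Q' : quiver n) : Prop :=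
  exists s : 'S_n, forall i j, `|Q' (s i) (s j)| = `|Q i j|.

Definition connected n (Q : quiver n) : Prop :=
  forall i j : 'I_n, connect (fun x y => Q x y != 0) i j.

Definition total_weight n (Q : quiver n) : int :=
  \sum_i \sum_(j | 0 < Q i j) Q i j.

(* The vertices i, j, k are distinct since Q is skew-symmetric. *)
Definition cyclic3 (Q : quiver 3) : Prop :=
  exists i j k : 'I_3, [/\ 0 < Q i j, 0 < Q j k & 0 < Q k i].

Definition acyclic3 (Q : quiver 3) : Prop := ~ cyclic3 Q.

Definition cluster_cyclic (Q : quiver 3) : Prop :=
  forall Q' : quiver 3, mutation_equivalent Q Q' -> cyclic3 Q'.

Definition cluster_acyclic (Q : quiver 3) : Prop := ~ cluster_cyclic Q.

Fixpoint weight_decreasing n (Q : quiver n) (ks : seq 'I_n) : Prop :=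
  if ks is k :: ks' then
    total_weight (mutate Q k) < total_weight Q
    /\ weight_decreasing (mutate Q k) ks'
  else True.

Definition maximal_weight_decreasing n (Q : quiver n) (ks : seq 'I_n) : Prop :=
  weight_decreasing Q ks
  /\ forall k : 'I_n, ~ weight_decreasing Q (rcons ks k).

(* Main.v *)
Require Import Defs.
From mathcomp Require Import all_boot all_order all_algebra all_fingroup.
From mathcomp Require Import zify.

(* Up to orientation and relabelling, a quiver of order 3 is given by its three
   weights and by whether it is cyclic; call two quivers equivalent when these
   agree. Mutation is an involution, a mutation that preserves the total weight
   stays in the equivalence class, and a weight-decreasing mutation only starts
   at a cyclic quiver, where it replaces a weight z by |x y - z|. If z and y can
   both be decreased, then x y < 2 z and x z < 2 y force x = 1, and for z < y
     (1, y, z) -> (1, y, y - z) -> (1, z, y - z)  and  (1, y, z) -> (1, y - z, z)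
   end in equivalent acyclic quivers. So weight-decreasing mutations are locally
   confluent, and by Newman's argument all maximal weight-decreasing sequences
   in a mutation class end in one equivalence class. It is acyclic as soon as
   the class contains an acyclic quiver, which admits no decreasing mutation. *)

Set Implicit Arguments.
Unset Strict Implicit.
Unset Printing Implicit Defensive.

Import Order.TTheory GRing.Theory Num.Theory.

Local Open Scope ring_scope.

(** * Signed edge weights of a quiver of order 3 *)

Implicit Types (Q N : quiver 3) (i j k l m : 'I_3).

(* The weight of the edge opposite to the vertex k, signed by its direction along
   the cycle 0 -> 1 -> 2 -> 0; vertices are added modulo 3. *)
Definition edge (Q : quiver 3) (k : 'I_3) : int := Q (k + 1) (k + 2).

Definition wt (Q : quiver 3) (k : 'I_3) : int := `|edge Q k|.

(** The two disjuncts are the two directions in which the triangle can be oriented. A boolean form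
    lets [equiv] compare cyclicity by an equation. *)
Definition cyc (Q : quiver 3) : bool :=
  [forall k, 0 < edge Q k] || [forall k, edge Q k < 0].

Lemma quiver_skewE n (Q : quiver n) (i j : 'I_n) : Q j i = - Q i j.
Proof. by have /matrixP/(_ i j) := quiver_skew Q; rewrite !mxE. Qed.

Lemma quiver_diag n (Q : quiver n) (i : 'I_n) : Q i i = 0.
Proof. by have := quiver_skewE Q i i; lia. Qed.

Lemma ord3_third (k l m : 'I_3) : uniq [:: k; l; m] ->
  (l = k + 1 /\ m = k + 2) \/ (l = k + 2 /\ m = k + 1).
Proof.
by case: k l m => [[|[|[]]] // ?] [[|[|[]]] // ?] [[|[|[]]] // ?] // _;
  [left|right|right|left|left|right]; split; apply: val_inj.
Qed.

Lemma ord3_uniq (k : 'I_3) : uniq [:: k; k + 1; k + 2].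
Proof. by case: k => [[|[|[]]] // ?]. Qed.

Lemma ord3_cases (k l m i : 'I_3) : uniq [:: k; l; m] ->
  [\/ i = k, i = l | i = m].
Proof.
move=> u; case: (eqVneq i k) => [|ik]; first by constructor 1.
case: (eqVneq i l) => [|il]; first by constructor 2.
constructor 3; move: u ik il.
by case: k => [[|[|[]]] // ?]; case: l => [[|[|[]]] // ?];
  case: m => [[|[|[]]] // ?]; case: i => [[|[|[]]] // ?] //= *; apply: val_inj.
Qed.

(** The three vertices sum to 0 modulo 3, which gives the third one in closed form. *)
Lemma uniq_third k l : k != l -> uniq [:: k; l; - (k + l)].
Proof.
by case: k => [[|[|[]]] // ?]; case: l => [[|[|[]]] // ?].
Qed.

Lemma uniq_swap k l m : uniq [:: k; l; m] -> uniq [:: l; k; m].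
Proof.
rewrite /= !inE !negb_or [l == k]eq_sym andbACA.
by case/and3P => /andP[-> ->] ->.
Qed.

Lemma wtE Q k l m : uniq [:: k; l; m] -> `|Q l m| = wt Q k.
Proof.
case/ord3_third => -[-> ->] //.
by rewrite quiver_skewE normrN.
Qed.

Lemma wt_ge0 Q k : 0 <= wt Q k.
Proof. exact: normr_ge0. Qed.

Lemma sum_ord3 (F : 'I_3 -> int) k l m : uniq [:: k; l; m] ->
  \sum_i F i = F k + F l + F m.
Proof.
rewrite /= !inE => /and3P[/norP[kl km] lm _].
rewrite (bigD1 k) //= (bigD1 l) //=; last by rewrite eq_sym.
rewrite (bigD1 m) /=; last by rewrite ![m == _]eq_sym km.
rewrite big1 ?addr0 ?addrA // => i /andP[/andP[ik il] im].
have u : uniq [:: k; l; m] by rewrite /= !inE negb_or kl km lm.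
by have [] := ord3_cases i u => e; rewrite e eqxx in ik il im.
Qed.

(** Of the two opposite entries of an edge only one is positive, so each edge is counted once. *)
Lemma total_weightE Q : total_weight Q = \sum_k wt Q k.
Proof.
rewrite /total_weight (sum_ord3 _ (ord3_uniq 0)).
under eq_bigr do rewrite big_mkcond.
have P i : \sum_j (if 0 < Q i j then Q i j else 0) =
  Num.max 0 (Q i 0) + Num.max 0 (Q i (0 + 1)) + Num.max 0 (Q i (0 + 2)).
  by rewrite (sum_ord3 _ (ord3_uniq 0)).
rewrite (eq_bigr _ (fun i _ => P i)) (sum_ord3 _ (ord3_uniq 0)).
rewrite /wt /edge !quiver_diag.
have -> : (0 + 1 + 1 : 'I_3) = 0 + 2 by apply: val_inj.
have -> : (0 + 1 + 2 : 'I_3) = 0 by apply: val_inj.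
have -> : (0 + 2 + 1 : 'I_3) = 0 by apply: val_inj.
have -> : (0 + 2 + 2 : 'I_3) = 0 + 1 by apply: val_inj.
rewrite (quiver_skewE Q 0 (0 + 1)) (quiver_skewE Q 0 (0 + 2)).
rewrite (quiver_skewE Q (0 + 1) (0 + 2)).
by move: (Q 0 (0 + 1)) (Q 0 (0 + 2)) (Q (0 + 1) (0 + 2)); lia.
Qed.

Lemma total_weight3 Q k l m : uniq [:: k; l; m] ->
  total_weight Q = wt Q k + wt Q l + wt Q m.
Proof. by rewrite total_weightE; apply: sum_ord3. Qed.

Lemma quiver_neq n (Q : quiver n) (i j : 'I_n) : 0 < Q i j -> i != j.
Proof. by apply: contraTneq => ->; rewrite quiver_diag ltxx. Qed.

Lemma cyclic3P Q : cyclic3 Q <-> cyc Q.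
Proof.
have E k : (Q k (k + 1) = edge Q (k + 2)) * (Q (k + 2) k = edge Q (k + 1)).
  by split; congr (Q _ _); case: k => [[|[|[]]] // ?]; apply: val_inj.
split=> [[i [j [k [ij jk ki]]]]|].
  have u : uniq [:: i; j; k].
    rewrite /= !inE negb_or (quiver_neq ij) (quiver_neq jk).
    by rewrite eq_sym (quiver_neq ki).
  apply/orP; case: (ord3_third u) => -[ej ek]; subst; [left|right];
    apply/forallP => l; move: ij jk ki.
    by rewrite -/(edge Q i) !E; case: (ord3_cases l (ord3_uniq i)) => ->.
  rewrite (quiver_skewE Q i (i + 1)) (quiver_skewE Q (i + 2) i).
  rewrite (quiver_skewE Q (i + 1) (i + 2)).
  rewrite -/(edge Q i) !E !oppr_gt0.
  by case: (ord3_cases l (ord3_uniq i)) => ->.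
case/orP => /forallP h.
  by exists 0, (0 + 1), (0 + 2); rewrite !E; split; apply: h.
(* Negative signs mean that the cycle runs backwards, [0 -> 2 -> 1 -> 0]. *)
exists 0, (0 + 2), (0 + 1).
rewrite (quiver_skewE Q 0 (0 + 1)) (quiver_skewE Q (0 + 2) 0).
rewrite (quiver_skewE Q (0 + 1) (0 + 2)).
by rewrite !E !oppr_gt0; split; apply: h.
Qed.

(** * Effect of a mutation on weights and cyclicity *)

Definition mut_term (a b : int) : int := ((`|a| * b + a * `|b|) %/ 2)%Z.

(** The two products cancel when the signs differ and coincide when they agree. *)
Lemma mut_termE a b : mut_term a b =
  if (0 < a) && (0 < b) then a * b
  else if (a < 0) && (b < 0) then - (a * b) else 0.
Proof.
have half (x : int) : ((x + x) %/ 2)%Z = x.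
  by rewrite -mulr2n -[x *+ 2]mulr_natr mulzK.
rewrite /mut_term.
case: (ltrgt0P a) => [a0|a0|->]; case: (ltrgt0P b) => [b0|b0|->] //=;
  rewrite ?mulr0 ?mul0r ?normr0 ?add0r ?addr0 ?mulr0 ?mul0r ?div0z //.
- by rewrite mulrN addrN.
- by rewrite mulNr addNr.
- by rewrite mulNr mulrN half.
Qed.

Lemma mut_termN a b : mut_term (- a) (- b) = - mut_term a b.
Proof.
rewrite !mut_termE !oppr_gt0 !oppr_lt0 mulrNN.
by case: (ltrgt0P a); case: (ltrgt0P b) => //=; lia.
Qed.

Lemma mut_termC a b : mut_term a b = mut_term b a.
Proof. by rewrite !mut_termE (mulrC b) (andbC (0 < b)) (andbC (b < 0)). Qed.

(** The path from [k + 1] through [k] to [k + 2] runs against the reference cycle, so both of its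
    entries are negated signed weights; hence the minus sign before [mut_term]. *)
Lemma edge_mutate Q k l m : uniq [:: k; l; m] ->
  [/\ edge (mutate Q k) k = edge Q k - mut_term (edge Q l) (edge Q m),
      edge (mutate Q k) l = - edge Q l & edge (mutate Q k) m = - edge Q m].
Proof.
have N i : (i == i + 1 = false) * (i == i + 2 = false)
   * (i + 1 == i = false) * (i + 2 == i = false)
   * (i + 1 + 1 = i + 2) * (i + 1 + 2 = i) * (i + 2 + 1 = i)
   * (i + 2 + 2 = i + 1) :> Prop.
  by do !split; case: i => [[|[|[]]] // ?]; try exact: val_inj.
have M : [/\ edge (mutate Q k) k
   = edge Q k - mut_term (edge Q (k + 1)) (edge Q (k + 2)),
   edge (mutate Q k) (k + 1) = - edge Q (k + 1)
   & edge (mutate Q k) (k + 2) = - edge Q (k + 2)].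
  rewrite /edge !mxE !N !eqxx /= ; split => //.
  rewrite -mut_termN -!quiver_skewE mut_termC //.
by case/ord3_third => -[-> ->] //; case: M => -> -> ->; rewrite mut_termC.
Qed.

Lemma cycE Q k l m : uniq [:: k; l; m] ->
  cyc Q = [&& 0 < edge Q k, 0 < edge Q l & 0 < edge Q m]
       || [&& edge Q k < 0, edge Q l < 0 & edge Q m < 0].
Proof.
move=> u; congr (_ || _); apply/forallP/and3P => [h|[hk hl hm] i];
  by [split; apply: h | case: (ord3_cases i u) => ->].
Qed.

Lemma wt_mutate_l Q k l m : uniq [:: k; l; m] -> wt (mutate Q k) l = wt Q l.
Proof. by rewrite /wt => /(edge_mutate Q)[_ -> _]; rewrite normrN. Qed.

Lemma wt_mutate_r Q k l m : uniq [:: k; l; m] -> wt (mutate Q k) m = wt Q m.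
Proof. by rewrite /wt => /(edge_mutate Q)[_ _ ->]; rewrite normrN. Qed.

Lemma cyc_wt_gt0 Q k : cyc Q -> 0 < wt Q k.
Proof.
by rewrite normr_gt0 => /orP[] /forallP/(_ k); [apply: lt0r_neq0|apply: ltr0_neq0].
Qed.

(** The two edges at [k] are reversed, so the triangle stays cyclic exactly when the product is
    large enough to reverse the third edge as well. *)
Lemma mutate_cyc Q k l m : uniq [:: k; l; m] -> cyc Q ->
  wt (mutate Q k) k = `|wt Q l * wt Q m - wt Q k|
  /\ cyc (mutate Q k) = (wt Q k < wt Q l * wt Q m).
Proof.
move=> u; rewrite !(cycE _ u) /wt; have [-> -> ->] := edge_mutate Q u.
rewrite mut_termE.
move: (edge Q k) (edge Q l) (edge Q m) => c a b.
case/orP => /and3P[c0 a0 b0].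
  have p0 : 0 < a * b by rewrite mulr_gt0.
  rewrite a0 b0 /= (gtr0_norm a0) (gtr0_norm b0); lia.
have p0 : 0 < a * b by rewrite nmulr_rgt0.
rewrite a0 b0 (ltr0_norm a0) (ltr0_norm b0) mulrNN.
have [-> ->] : (0 < a) = false /\ (0 < b) = false by lia.
by move=> /=; lia.
Qed.

(** If the edges at [k] form a path through [k], acyclicity makes the third edge parallel to that
    path or absent, so its weight grows strictly. Otherwise the correction is 0, and reversing the
    edges at [k] creates no cycle. *)
Lemma mutate_acyc Q k l m : uniq [:: k; l; m] -> ~~ cyc Q ->
  wt Q k <= wt (mutate Q k) k
  /\ (wt (mutate Q k) k = wt Q k -> ~~ cyc (mutate Q k)).
Proof.
move=> u; rewrite !(cycE _ u) /wt; have [-> -> ->] := edge_mutate Q u.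
rewrite mut_termE.
move: (edge Q k) (edge Q l) (edge Q m) => c a b.
case: ifP => [/andP[a0 b0]|na].
  by have := mulr_gt0 a0 b0; move: (a * b) => p; lia.
case: ifP => [/andP[a0 b0]|nb]; last by lia.
have : 0 < a * b by rewrite nmulr_rgt0.
by move: (a * b) => p; lia.
Qed.

(** The first mutation negates both arguments of [mut_term], so the two corrections cancel. *)
Lemma mutateK_edge Q k i : edge (mutate (mutate Q k) k) i = edge Q i.
Proof.
have u := ord3_uniq k.
have [ek el em] := edge_mutate (mutate Q k) u.
have [ek' el' em'] := edge_mutate Q u.
case: (ord3_cases i u) => ->.
- by rewrite ek ek' el' em' mut_termN opprK subrK.
- by rewrite el el' opprK.
- by rewrite em em' opprK.
Qed.

(** * Equivalence of quivers *)

Definition equiv Q Q' :=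
  cyc Q = cyc Q' /\ exists s : 'S_3, forall k, wt Q' (s k) = wt Q k.

Definition lowers Q k := total_weight (mutate Q k) < total_weight Q.

Lemma equiv_wt Q Q' : cyc Q = cyc Q' -> wt Q' =1 wt Q -> equiv Q Q'.
Proof. by move=> ec ew; split=> //; exists 1%g => k; rewrite perm1. Qed.

Lemma equiv_refl Q : equiv Q Q.
Proof. exact: equiv_wt. Qed.

Lemma equiv_sym Q Q' : equiv Q Q' -> equiv Q' Q.
Proof.
by case=> ec [s es]; split=> //; exists (s^-1)%g => k; rewrite -es permKV.
Qed.

Lemma equiv_trans Q1 Q2 Q3 : equiv Q1 Q2 -> equiv Q2 Q3 -> equiv Q1 Q3.
Proof.
case=> ec [s es] [ec' [s' es']]; split; first by rewrite ec.
by exists (s * s')%g => k; rewrite permM es' es.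
Qed.

Lemma equiv_total Q Q' : equiv Q Q' -> total_weight Q' = total_weight Q.
Proof.
case=> _ [s es]; rewrite !total_weightE (reindex_inj (@perm_inj _ s)).
exact: eq_bigr.
Qed.

Lemma equiv_mutateK Q k : equiv Q (mutate (mutate Q k) k).
Proof.
apply: equiv_wt => [|i]; last by rewrite /wt mutateK_edge.
by rewrite !(cycE _ (ord3_uniq 0)) !mutateK_edge.
Qed.

Lemma perm_uniq3 (s : 'S_3) k l m :
  uniq [:: k; l; m] -> uniq [:: s k; s l; s m].
Proof. by move: (map_inj_uniq (@perm_inj _ s) [:: k; l; m]) => <-. Qed.

(** In a triangle, a permutation of the edges is induced by the same permutation of the opposite
    vertices. *)
Lemma equiv_underlying Q Q' : equiv Q Q' -> same_underlying_graph Q Q'.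
Proof.
case=> _ [s es]; exists s => i j.
case: (eqVneq i j) => [->|ij]; first by rewrite !quiver_diag.
have u : uniq [:: - (i + j); i; j] by rewrite -(rot_uniq 1) uniq_third.
by rewrite (wtE Q u) (wtE Q' (perm_uniq3 s u)).
Qed.

Lemma isomorphic_equiv Q Q' : isomorphic Q Q' -> equiv Q Q'.
Proof.
case=> s es; split.
  apply/idP/idP => /cyclic3P [i [j [k h]]]; apply/cyclic3P.
    by exists (s i), (s j), (s k); rewrite !es.
  exists (s^-1 i)%g, (s^-1 j)%g, (s^-1 k)%g.
  by rewrite -!es !permKV.
exists s => k.
have u := ord3_uniq k.
by rewrite -(wtE Q' (perm_uniq3 s u)) es.
Qed.

(** * Weight-decreasing mutations and equivalence *)

(** Since [x y > 0] in a cyclic quiver, [|x y - z| < z] amounts to [x y < 2 z]. *)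
Lemma lowers_cyc Q k l m : uniq [:: k; l; m] ->
  lowers Q k = cyc Q && (wt Q l * wt Q m < wt Q k *+ 2).
Proof.
move=> u; rewrite /lowers !(total_weight3 _ u) (wt_mutate_l _ u) (wt_mutate_r _ u).
case: (boolP (cyc Q)) => [cQ|cQ].
  have [-> _] := mutate_cyc u cQ.
  have : 0 < wt Q l * wt Q m by rewrite mulr_gt0 ?cyc_wt_gt0.
  by have := cyc_wt_gt0 k cQ; lia.
have [] := mutate_acyc u cQ; lia.
Qed.

Lemma equal_total_equiv Q k :
  total_weight (mutate Q k) = total_weight Q -> equiv Q (mutate Q k).
Proof.
have u := ord3_uniq k.
rewrite !(total_weight3 _ u) (wt_mutate_l _ u) (wt_mutate_r _ u).
move=> /addIr/addIr ew; apply: equiv_wt => [|i]; last first.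
  by case: (ord3_cases i u) => ->; rewrite ?(wt_mutate_l _ u) ?(wt_mutate_r _ u).
case: (boolP (cyc Q)) => [cQ|cQ].
  have [e ->] := mutate_cyc u cQ.
  (* Equal weights force [x y = 2 z], hence [z < x y], and the quiver stays cyclic. *)
  have : 0 < wt Q (k + 1) * wt Q (k + 2) by rewrite mulr_gt0 ?cyc_wt_gt0.
  by have := cyc_wt_gt0 k cQ; move: e; rewrite ew; lia.
by have [_ /(_ ew)/negbTE->] := mutate_acyc u cQ.
Qed.

(** A decreasing mutation starts at a cyclic quiver, where weights alone determine the outcome up to
    equivalence; at an acyclic quiver the orientation would matter. *)
Lemma equiv_mutate Q Q' k : equiv Q Q' -> lowers Q k ->
  exists2 k', lowers Q' k' & equiv (mutate Q k) (mutate Q' k').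
Proof.
case=> ec [s es].
have u := ord3_uniq k.
have us := perm_uniq3 s u.
rewrite (lowers_cyc _ u) => /andP[cQ lo].
exists (s k); first by rewrite (lowers_cyc _ us) -ec cQ !es.
have cQ' : cyc Q' by rewrite -ec.
have [ek ck] := mutate_cyc u cQ.
have [ek' ck'] := mutate_cyc us cQ'.
split; first by rewrite ck ck' !es.
exists s => i; case: (ord3_cases i u) => ->.
- by rewrite ek ek' !es.
- by rewrite (wt_mutate_l _ u) (wt_mutate_l _ us) es.
- by rewrite (wt_mutate_r _ u) (wt_mutate_r _ us) es.
Qed.

(** * Local confluence *)

Lemma equiv_tperm Q Q' k l m : uniq [:: k; l; m] -> cyc Q = cyc Q' ->
  wt Q' k = wt Q l -> wt Q' l = wt Q k -> wt Q' m = wt Q m -> equiv Q Q'.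
Proof.
move=> u ec ek el em; split=> //; exists (tperm k l) => i.
move: (u); rewrite /= !inE negb_or => /and3P[/andP[kl km] lm _].
by case: (ord3_cases i u) => ->; rewrite ?tpermL ?tpermR ?tpermD.
Qed.

Lemma lowers_two_wt Q k l m : uniq [:: k; l; m] ->
  lowers Q k -> lowers Q l -> cyc Q /\ wt Q m = 1.
Proof.
move=> u; have ul := uniq_swap u.
rewrite (lowers_cyc _ u) (lowers_cyc _ ul) => /andP[cQ hk] /andP[_ hl].
split=> //; move: (cyc_wt_gt0 k cQ) (cyc_wt_gt0 l cQ) (cyc_wt_gt0 m cQ) hk hl.
(* Adding the two inequalities and dividing by [wt Q k + wt Q l] gives [wt Q m < 2]. *)
by nia.
Qed.

Lemma lowers_two_lt Q k l m : uniq [:: k; l; m] ->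
  lowers Q k -> lowers Q l -> wt Q k < wt Q l ->
  exists2 j, lowers (mutate Q k) j
    & equiv (mutate Q l) (mutate (mutate Q k) j).
Proof.
move=> u lk ll kl; have ul := uniq_swap u.
have [cQ m1] := lowers_two_wt u lk ll; have k0 := cyc_wt_gt0 k cQ.
have [] := mutate_cyc u cQ; rewrite m1 mulr1 kl => Ak cA.
have [] := mutate_cyc ul cQ; rewrite m1 mulr1 => Bl cB.
have Al := wt_mutate_l Q u; have Am := wt_mutate_r Q u.
have Bk := wt_mutate_l Q ul; have Bm := wt_mutate_r Q ul.
(* After the mutation at [k] the quiver is still cyclic, with weight [wt Q l - wt Q k] at [k]. This
   is less than twice [wt Q l], so [l] can be lowered next. *)
exists l; first by rewrite (lowers_cyc _ ul) cA Ak Al Am m1; lia.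
have [] := mutate_cyc ul cA; rewrite Ak Al Am m1 mulr1 => Cl cC.
have Ck := wt_mutate_l (mutate Q k) ul; have Cm := wt_mutate_r (mutate Q k) ul.
(* Both routes end acyclic with weights 1, [wt Q k] and [wt Q l - wt Q k], the last two in exchanged
   positions. *)
apply: (equiv_tperm u).
- by rewrite cB cC; lia.
- by rewrite Ck Ak Bl; lia.
- by rewrite Cl Bk; lia.
- by rewrite Cm Am Bm.
Qed.

(** With [y] the common weight, either mutation gives an acyclic quiver with weights 1, [y], 0; the
    transposition of [k] and [l] matches the two. *)
Lemma lowers_two_eq Q k l m : uniq [:: k; l; m] ->
  lowers Q k -> lowers Q l -> wt Q k = wt Q l ->
  equiv (mutate Q l) (mutate Q k).
Proof.
move=> u lk ll kl; have ul := uniq_swap u.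
have [cQ m1] := lowers_two_wt u lk ll.
have [] := mutate_cyc u cQ; rewrite m1 mulr1 => Ak cA.
have [] := mutate_cyc ul cQ; rewrite m1 mulr1 => Bl cB.
apply: (equiv_tperm u).
- by rewrite cA cB kl.
- by rewrite Ak Bl kl.
- by rewrite (wt_mutate_l _ u) (wt_mutate_l _ ul).
- by rewrite (wt_mutate_r _ u) (wt_mutate_r _ ul).
Qed.

(** * Maximal decreasing sequences and Newman's argument *)

Lemma maximal_nil Q :
  maximal_weight_decreasing Q [::] <-> (forall k, ~~ lowers Q k).
Proof.
split=> [[_ h] k|h]; first by apply/negP => lk; apply: (h k).
by split=> // k [lk _]; case/negP: (h k).
Qed.

Lemma maximal_cons Q k ks : maximal_weight_decreasing Q (k :: ks) <->
  lowers Q k /\ maximal_weight_decreasing (mutate Q k) ks.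
Proof.
split=> [[[lk dk] h]|[lk [dk h]]]; split=> //.
  by split=> // l dl; apply: (h l).
by move=> l [_]; apply: h.
Qed.

(** Uniqueness of the normal form up to equivalence; [ex_reduces_to] supplies existence. *)
Definition reduces_to N Q :=
  forall ks, maximal_weight_decreasing Q ks -> equiv N (mutate_seq Q ks).

(** Decreasing steps are matched one by one by [equiv_mutate]; applied in the reverse direction, it
    also transfers maximality at the end. *)
Lemma equiv_maximal Q Q' ks : equiv Q Q' -> maximal_weight_decreasing Q ks ->
  exists2 ks', maximal_weight_decreasing Q' ks'
    & equiv (mutate_seq Q ks) (mutate_seq Q' ks').
Proof.
elim: ks Q Q' => [|k ks IH] Q Q' e.
  move/maximal_nil => nQ; exists [::] => //; apply/maximal_nil => k.
  apply/negP => lk; have [k' lk' _] := equiv_mutate (equiv_sym e) lk.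
  by case/negP: (nQ k').
case/maximal_cons => lk mk; have [k' lk' e'] := equiv_mutate e lk.
have [ks' mks' eks] := IH _ _ e' mk.
by exists (k' :: ks') => //; apply/maximal_cons.
Qed.

Lemma reduces_to_equiv N Q Q' : equiv Q Q' -> reduces_to N Q -> reduces_to N Q'.
Proof.
move=> e r ks mks; have [ks' mks' eks] := equiv_maximal (equiv_sym e) mks.
exact: equiv_trans (r _ mks') (equiv_sym eks).
Qed.

Lemma reduces_to_mutate N Q k :
  lowers Q k -> reduces_to N Q -> reduces_to N (mutate Q k).
Proof. by move=> lk r ks mks; apply: (r (k :: ks)); apply/maximal_cons. Qed.

Lemma total_weight_ge0 Q : 0 <= total_weight Q.
Proof. by rewrite total_weightE sumr_ge0 // => k _; apply: wt_ge0. Qed.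

(** Decreasing mutations terminate because the total weight is a nonnegative integer. *)
Lemma total_weight_ind (P : quiver 3 -> Prop) :
  (forall Q, (forall k, lowers Q k -> P (mutate Q k)) -> P Q) -> forall Q, P Q.
Proof.
move=> H Q; have [n] := ubnP `|total_weight Q|%N.
elim: n Q => // n IH Q hn; apply: H => k lk; apply: IH.
by move: lk hn; rewrite /lowers; have := total_weight_ge0 (mutate Q k); lia.
Qed.

(** Knowing the end class after one decreasing mutation [k] is enough: local confluence carries it
    over to any other decreasing mutation [l]. *)
Lemma reduces_to_lowers N Q k :
  lowers Q k -> reduces_to N (mutate Q k) -> reduces_to N Q.
Proof.
elim/total_weight_ind: Q k => Q IH k lk r [|l ks].
  by move/maximal_nil/(_ k); rewrite lk.
case/maximal_cons => ll mks; suff h : reduces_to N (mutate Q l) by exact: h.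
move=> {ks mks}.
case: (eqVneq k l) => [<- //|kl].
have u := uniq_third kl.
case: (ltrgtP (wt Q k) (wt Q l)) => c.
(* The quiver [mutate Q l] is equivalent to a reduct of [mutate Q k], so it inherits the end
   class. *)
- have [j lj e] := lowers_two_lt u lk ll c.
  exact: reduces_to_equiv (equiv_sym e) (reduces_to_mutate lj r).
(* Here [mutate Q k] is equivalent to a reduct of [mutate Q l]; going back up from that reduct needs
   the induction hypothesis at [mutate Q l]. *)
- have [j lj e] := lowers_two_lt (uniq_swap u) ll lk c.
  exact: IH lj (reduces_to_equiv e r).
- exact: reduces_to_equiv (equiv_sym (lowers_two_eq u lk ll c)) r.
Qed.

Lemma ex_reduces_to Q : exists2 ks,
  maximal_weight_decreasing Q ks & reduces_to (mutate_seq Q ks) Q.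
Proof.
elim/total_weight_ind: Q => Q IH.
case: (boolP [exists k, lowers Q k]) => [/existsP[k lk]|].
  have [ks mks r] := IH k lk.
  by exists (k :: ks); [apply/maximal_cons|apply: reduces_to_lowers r].
rewrite negb_exists => /forallP nQ; exists [::]; first exact/maximal_nil.
move=> [_|k ks /maximal_cons[lk]]; first exact: equiv_refl.
by case/negP: (nQ k).
Qed.

(* An increasing mutation is undone by a decreasing one. *)
Lemma reduces_to_mutation N Q k : reduces_to N Q -> reduces_to N (mutate Q k).
Proof.
move=> r; case: (ltrgtP (total_weight (mutate Q k)) (total_weight Q)) => c.
- exact: reduces_to_mutate.
- have e := equiv_mutateK Q k.
  apply: (@reduces_to_lowers _ _ k); last exact: reduces_to_equiv r.
  by rewrite /lowers (equiv_total e).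
- exact: reduces_to_equiv (equal_total_equiv c) r.
Qed.

(** * The end class as an invariant of the mutation class *)

Lemma reduces_to_class N Q Q' :
  mutation_equivalent Q Q' -> reduces_to N Q -> reduces_to N Q'.
Proof.
case=> ks /isomorphic_equiv e r; apply: reduces_to_equiv e _.
by elim: ks Q r => //= k ks IH Q r; apply: IH; apply: reduces_to_mutation.
Qed.

(** No mutation lowers an acyclic quiver, so the empty sequence is maximal. *)
Lemma reduces_to_acyc N Q : reduces_to N Q -> ~~ cyc Q -> equiv N Q.
Proof.
move=> r cQ; apply: (r [::]); apply/maximal_nil => k.
by rewrite (lowers_cyc _ (ord3_uniq k)) (negbTE cQ).
Qed.

Lemma weight_decreasing_le Q ks : weight_decreasing Q ks ->
  total_weight (mutate_seq Q ks) <= total_weight Q.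
Proof. by elim: ks Q => //= k ks IH Q [lk /IH]; lia. Qed.

Theorem theorem9p1 (S : quiver 3)
    (hconn : connected S) (hca : cluster_acyclic S) :
  exists S0 : quiver 3,
    [/\ (mutation_equivalent S S0 /\ acyclic3 S0)
        /\ (forall S1 : quiver 3,
              mutation_equivalent S S1 -> acyclic3 S1 ->
              same_underlying_graph S0 S1),
        forall S1 : quiver 3,
          mutation_equivalent S S1 -> total_weight S0 <= total_weight S1
      & forall ks : seq 'I_3,
          maximal_weight_decreasing S ks ->
          acyclic3 (mutate_seq S ks)
          /\ same_underlying_graph S0 (mutate_seq S ks)].
Proof.
have acycP Q : acyclic3 Q <-> ~~ cyc Q.
  by split=> [h|/negP h /cyclic3P//]; apply/negP => /cyclic3P.
have [ks0 _ r] := ex_reduces_to S; set S0 := mutate_seq S ks0 in r.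
(* If [S0] were cyclic, so would be every quiver of the class: an acyclic one would be equivalent to
   [S0], and equivalence preserves cyclicity. *)
have c0 : ~~ cyc S0.
  apply/negP => c0; apply: hca => Q eQ; apply/cyclic3P; apply: contraT => cQ.
  have [e _] := reduces_to_acyc (reduces_to_class eQ r) cQ.
  by rewrite -e c0 in cQ.
exists S0; split; first split.
- by split; [exists ks0; exists 1%g => i j; rewrite !perm1|apply/acycP].
- move=> S1 e1 /acycP c1; apply: equiv_underlying.
  exact: reduces_to_acyc (reduces_to_class e1 r) c1.
(* Reducing [S1] as far as possible never raises the weight and ends at a quiver equivalent to
   [S0]. *)
- move=> S1 e1; have [ks mks _] := ex_reduces_to S1.
  rewrite -(equiv_total (reduces_to_class e1 r mks)).
  by case: mks => /weight_decreasing_le.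
- move=> ks /r e; split; last exact: equiv_underlying.
  by apply/acycP; case: e => <-.
Qed.
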